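(* Let $f=(f_1,\dots,f_m)\colon\mathbb{R}^n\to\mathbb{R}^m$ and $g\colon\mathbb{R}^n\to Y$ be continuously Fréchet differentiable on $\mathbb{R}^n$, where $Y$ is a Banach space, let $\Theta\subset Y$ be a closed convex cone, and let $\mathcal{F}=\{x\in\mathbb{R}^n : g(x)\in-\Theta\}$. Assume that $\Theta$ is dually compact. Let $\bar x\in\mathcal{F}$ be such that the AKKT condition and the Robinson constraint qualification (RCQ) are satisfied at $\bar x$. Then the BAKKT condition holds at $\bar x$, and so does the KKT condition.
   Context: $\mathbb{R}^m_+$ is the nonnegative orthant of $\mathbb{R}^m$; $m,n\ge 1$; $\mathbb{R}^n$ has the Euclidean norm and usual scalar product (identified with its dual). $Y^*$ is the dual of $Y$, $\langle\cdot,\cdot\rangle$ is the canonical pairing, and $\Theta_+:=\{\mu\in Y^* : \langle\mu,\theta\rangle\ge 0\ \ \forall\theta\in\Theta\}$. $\nabla f_i(x)$ is the gradient of $f_i$, $\nabla g(x)\colon\mathbb{R}^n\to Y$ is the derivative of $g$ at $x$, and $\nabla g(x)^*\colon Y^*\to\mathbb{R}^n$ is its adjoint. The closed convex cone $\Theta$ is dually compact if there exists a (norm-)compact subset $K$ of $Y$ such that every $y^*\in\Theta_+$ satisfies $\|y^*\|\le\sup\{\langle y^*,y\rangle : y\in K\}$. The point $\bar x\in\mathcal{F}$ satisfies the RCQ if $0\in\mathrm{int}\,[g(\bar x)+\nabla g(\bar x)(\mathbb{R}^n)+\Theta]$, where $\mathrm{int}$ is the topological interior in $Y$. A point $\bar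 x\in\mathcal{F}$ satisfies the KKT condition if there exists $(\lambda,\mu)\in\mathbb{R}^m_+\times\Theta_+$ such that $\sum_{i=1}^m\lambda_i=1$, $\nabla g(\bar x)^*\mu+\sum_{i=1}^m\lambda_i\nabla f_i(\bar x)=0$, and $\langle\mu,g(\bar x)\rangle=0$. A point $\bar x\in\mathcal{F}$ satisfies the AKKT (approximate Karush--Kuhn--Tucker) condition if there exist $\lambda\in\mathbb{R}^m_+$ with $\sum_{i=1}^m\lambda_i=1$ and sequences $\{x^k\}\subset\mathbb{R}^n$ (not required to be feasible) and $\{\mu^k\}\subset\Theta_+$ such that, as $k\to\infty$: $x^k\to\bar x$; $\nabla g(x^k)^*\mu^k+\sum_{i=1}^m\lambda_i\nabla f_i(\bar x)\to 0$; and $\langle\mu^k,g(x^k)\rangle\to 0$. A point $\bar x\in\mathcal{F}$ satisfies the BAKKT (bounded AKKT) condition if such $\lambda$, $\{x^k\}$, $\{\mu^k\}$ exist with, in addition, $\{\mu^k\}$ bounded in the norm of $Y^*$. *)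

(* Defs.v *)
From HB Require Import structures.
From mathcomp Require Import all_boot all_order all_algebra.
From mathcomp Require Import all_classical all_reals all_analysis.

Set Implicit Arguments.
Unset Strict Implicit.
Unset Printing Implicit Defensive.

Import Order.TTheory GRing.Theory Num.Theory.
Import numFieldNormedType.Exports.

Local Open Scope classical_set_scope.
Local Open Scope ring_scope.

(* R^n is 'rV[R]_n with the library's topology.  The library norms it by the
   maximum norm, which is equivalent to the Euclidean one; the norm of R^n is
   used below only through notions invariant under equivalent norms
   (convergence, differentiability, continuity of the derivative).  Gradients
   and adjoints are taken for the usual scalar product. *)

Section Operators.
Context {R : realType}.

(* Extended-valued, so that unbounded maps get +oo and no value is junk. *)
Definition opnorm (V W : normedModType R) (A : V -> W) : \bar R :=
  ereal_sup [set `|A v|%:E | v in [set v : V | `|v| <= 1]].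

Definition continuously_differentiable (V W : normedModType R) (g : V -> W) :=
  (forall x, differentiable g x) /\
  (forall x, opnorm (fun h => 'd g y h - 'd g x h) @[y --> x] --> 0%E).

Definition scalar_product (n : nat) (u v : 'rV[R]_n) : R :=
  \sum_(j < n) u 0 j * v 0 j.

(* Identification of R^n with its dual: the vector representing a linear form;
   see scalar_product_riesz. *)
Definition riesz (n : nat) (l : 'rV[R]_n -> R) : 'rV[R]_n :=
  \row_j l (delta_mx 0 j).

Lemma scalar_product_riesz (n : nat) (l : {linear 'rV[R]_n -> R^o})
  (h : 'rV[R]_n) : scalar_product (riesz l) h = l h.
Proof.
rewrite [in RHS](row_sum_delta h) linear_sum; apply: eq_bigr => j _.
by rewrite linearZ mxE [RHS]mulrC.
Qed.

Definition gradient (n : nat) (phi : 'rV[R]_n -> R^o) (x : 'rV[R]_n) :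
  'rV[R]_n := riesz ('d phi x).

Definition adjoint (n : nat) (Y : normedModType R)
  (A : {linear 'rV[R]_n -> Y}) (mu : {linear Y -> R^o}) : 'rV[R]_n :=
  riesz (mu \o A).

Lemma scalar_product_adjoint (n : nat) (Y : normedModType R)
  (A : {linear 'rV[R]_n -> Y}) (mu : {linear Y -> R^o}) (h : 'rV[R]_n) :
  scalar_product (adjoint A mu) h = mu (A h).
Proof. exact: (scalar_product_riesz (mu \o A)). Qed.

End Operators.

Section Cones.
Context {R : realType} {Y : normedModType R}.
Implicit Type Theta : set Y.

Definition closed_convex_cone Theta :=
  [/\ Theta !=set0, closed Theta, convex_set Theta &
      forall (t : R) y, 0 <= t -> Theta y -> Theta (t *: y)].

(* Y^* consists of the continuous elements of {linear Y -> R^o}. *)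
Definition dual_cone Theta : set {linear Y -> R^o} :=
  [set mu : {linear Y -> R^o} |
    continuous mu /\ forall theta, Theta theta -> 0 <= mu theta].

Definition dually_compact Theta :=
  exists2 K : set Y, compact K &
    forall mu : {linear Y -> R^o}, dual_cone Theta mu ->
      (opnorm mu <= ereal_sup [set (mu y)%:E | y in K])%E.

End Cones.

Section Conditions.
Context {R : realType} {m n : nat} {Y : normedModType R}.
Variables (f : 'rV[R]_n -> 'rV[R]_m) (g : 'rV[R]_n -> Y) (Theta : set Y).
Implicit Types (x xbar : 'rV[R]_n) (lambda : 'rV[R]_m).

Definition feasible_set : set 'rV[R]_n := [set x | Theta (- g x)].

Definition RCQ xbar :=
  interior [set g xbar + 'd g xbar h + theta | h in setT & theta in Theta] 0.

Definition normalized_multiplier lambda :=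
  (forall i, 0 <= lambda 0 i) /\ \sum_(i < m) lambda 0 i = 1.

Definition grad_combination lambda x : 'rV[R]_n :=
  \sum_(i < m) lambda 0 i *: gradient (fun z => f z 0 i) x.

Definition KKT xbar :=
  exists lambda, exists mu : {linear Y -> R^o},
    [/\ normalized_multiplier lambda, dual_cone Theta mu,
        adjoint ('d g xbar) mu + grad_combination lambda xbar = 0 &
        mu (g xbar) = 0].

(* The gradients of f are taken at the limit xbar, the derivative of g at the
   moving points xk k. *)
Definition AKKT_sequence xbar lambda (xk : nat -> 'rV[R]_n)
    (muk : nat -> {linear Y -> R^o}) :=
  [/\ forall k, dual_cone Theta (muk k),
      xk k @[k --> \oo] --> xbar,
      adjoint ('d g (xk k)) (muk k) + grad_combination lambda xbar
        @[k --> \oo] --> (0 : 'rV[R]_n) &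
      (muk k (g (xk k)) : R) @[k --> \oo] --> (0 : R)].

Definition AKKT xbar :=
  exists lambda xk muk,
    normalized_multiplier lambda /\ AKKT_sequence xbar lambda xk muk.

Definition BAKKT xbar :=
  exists lambda xk muk,
    [/\ normalized_multiplier lambda, AKKT_sequence xbar lambda xk muk &
        exists M : R, forall k, (opnorm (muk k) <= M%:E)%E].

End Conditions.

(* Main.v *)
(* Fix [y].  By the RCQ, [- (d *: y) = g xbar + 'd g xbar h + theta] for some
   [d > 0], [h] and [theta \in Theta]; pairing with [muk k], and comparing with
   the convergent quantities [muk k (g (xk k))] and [muk k ('d g (xk k) h)],
   yields [muk k y <= C + o(1) * N k], where [N k] is the norm of [muk k].  Dual
   compactness makes this uniform over a compact set that computes [N k], whence
   [N k <= C + N k / 2]: the multipliers are bounded.  A pointwise limit of them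
   along an ultrafilter is then a KKT multiplier. *)

Require Import Defs.
From HB Require Import structures.
From mathcomp Require Import all_boot all_order all_algebra.
From mathcomp Require Import all_classical all_reals all_analysis.
From mathcomp Require Import ring lra.
Import Order.TTheory GRing.Theory Num.Theory.
Import numFieldNormedType.Exports.
Local Open Scope classical_set_scope.
Local Open Scope ring_scope.

Set Implicit Arguments.
Unset Strict Implicit.

(** * Operator norms and the scalar product *)

Lemma opnorm_ge0 (R : realType) (V W : normedModType R) (A : V -> W) :
  (0 <= opnorm A)%E.
Proof.
apply: (@le_trans _ _ `|A 0|%:E); first by rewrite lee_fin.
by apply: ereal_sup_ubound; exists 0; rewrite //= normr0.
Qed.

Lemma opnorm_le_bound (R : realType) (V W : normedModType R)
    (A : {linear V -> W}) (c : R) (v : V) :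
  (opnorm A <= c%:E)%E -> `|A v| <= c * `|v|.
Proof.
move=> Ac; have [->|v0] := eqVneq v 0; first by rewrite linear0 !normr0 mulr0.
have nv : 0 < `|v| by rewrite normr_gt0.
have : `|A (`|v|^-1 *: v)| <= c.
  rewrite -lee_fin; apply: le_trans Ac; apply: ereal_sup_ubound.
  exists (`|v|^-1 *: v) => //=.
  by rewrite normrZ ger0_norm ?invr_ge0 // mulVf ?gt_eqF.
rewrite linearZ normrZ ger0_norm ?invr_ge0 //.
by rewrite mulrC ler_pdivrMr.
Qed.

Lemma continuous_opnorm (R : realType) (V W : normedModType R)
    (A : {linear V -> W}) :
  continuous A -> exists2 c : R, 0 <= c & opnorm A = c%:E.
Proof.
move=> /linear_bounded_continuous /linear_boundedP Ab.
have [r] : exists r : R, forall x, `|A x| <= r * `|x|.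
  by near (pinfty_nbhs R) => r; exists r; near: r.
move=> rA.
(* If [V] is trivial, [r] may be negative, hence the maximum with 0. *)
have opr : (opnorm A <= (Num.max r 0)%:E)%E.
  apply: ge_ereal_sup => _ [v /= v1 <-]; rewrite lee_fin (le_trans (rA v))//.
  apply: (@le_trans _ _ (Num.max r 0 * `|v|)).
    by rewrite ler_wpM2r// le_max lexx.
  by rewrite ler_piMr// le_max lexx orbT.
have := opnorm_ge0 A; case: (opnorm A) opr => // c _; rewrite lee_fin.
by exists c.
Unshelve. all: by end_near. Qed.

Lemma scalar_product_cvg (R : realType) (n : nat) (T : Type) (F : set_system T)
    {FF : Filter F} (a : T -> 'rV[R]_n) (b h : 'rV[R]_n) :
  a t @[t --> F] --> b ->
  (scalar_product (a t) h : R) @[t --> F] --> (scalar_product b h : R).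
Proof.
move=> ab; apply: cvg_big => [|i _]; first exact: add_continuous.
apply: cvgM; last exact: cvg_cst.
apply: (cvg_comp a (fun v : 'rV[R]_n => v 0 i) ab).
exact: coord_continuous.
Qed.

Lemma scalar_productDl (R : realType) (n : nat) (a b h : 'rV[R]_n) :
  scalar_product (a + b) h = scalar_product a h + scalar_product b h.
Proof.
by rewrite -big_split; apply: eq_bigr => i _; rewrite /= mxE mulrDl.
Qed.

Lemma scalar_product_delta (R : realType) (n : nat) (a : 'rV[R]_n) (j : 'I_n) :
  scalar_product a (delta_mx 0 j) = a 0 j.
Proof.
rewrite /scalar_product (bigD1 j)//= mxE !eqxx mulr1 big1 ?addr0// => i ij.
by rewrite mxE (negPf ij) andbF mulr0.
Qed.

Lemma continuously_differentiable_cvg (R : realType) (V W : normedModType R)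
    (g : V -> W) (T : Type) (F : set_system T) {FF : Filter F}
    (x : T -> V) (a h : V) :
  continuously_differentiable g -> x t @[t --> F] --> a ->
  'd g (x t) h @[t --> F] --> 'd g a h.
Proof.
move=> [_ /(_ a) dg] xa.
have {}dg : opnorm (fun h => 'd g (x t) h - 'd g a h) @[t --> F] --> 0%E.
  exact: cvg_comp xa dg.
apply/cvgrPdist_le => e e0.
have c0 : 0 < e / (`|h| + 1) by rewrite divr_gt0// ltr_wpDl.
(* Convergence to [0%E] makes the extended-valued norm eventually finite, so its real value can be
   estimated. *)
have /fine_cvgP[dfin dcvg] := dg.
near=> t.
rewrite distrC.
have opc : (opnorm ('d g (x t) \- 'd g a)%R <= (e / (`|h| + 1))%:E)%E.
  rewrite -[leLHS]fineK; last by near: t.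
  rewrite lee_fin; near: t.
  exact: cvgr_le dcvg _ c0.
apply: le_trans (opnorm_le_bound (A := 'd g (x t) \- 'd g a) h opc) _.
by rewrite mulrAC ler_pdivrMr ?ltr_wpDl// ler_pM2l// lerDl.
Unshelve. all: by end_near. Qed.

(** * Compactness: ultrafilter limits and uniform norm bounds *)

(** The image of [U] clusters in the compact segment. A cluster point is a limit, since [U] contains
    the preimage of each neighbourhood or its complement, and the complement would contradict
    clustering. *)
Lemma bounded_ultra_cvg (R : realType) (T : Type) (U : set_system T)
    (UU : UltraFilter U) (u : T -> R) (M : R) :
  (forall t, `|u t| <= M) -> exists l : R, u t @[t --> U] --> l.
Proof.
move=> uM; have := @segment_compact R (- M) M.
move=> /(_ (u t @[t --> U]) (fmap_proper_filter u ultra_proper)) [].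
  by apply: (@filterE _ U) => t; rewrite /= in_itv /= -ler_norml.
move=> l [_ lU]; exists l => N Nl /=.
have [//|UN] := in_ultra_setVsetC (u @^-1` N) UU.
by have [r []] := lU (~` N) N UN Nl.
Qed.

(* The existence part of the Banach-Alaoglu theorem: a weak-* limit is computed
   pointwise along an ultrafilter. *)
Lemma bounded_linear_ultra_cvg (R : realType) (Y : normedModType R) (T : Type)
    (U : set_system T) (UU : UltraFilter U) (mu : T -> {linear Y -> R^o})
    (M : R) :
  (forall t y, `|mu t y| <= M * `|y|) ->
  exists2 nu : {linear Y -> R^o}, continuous nu &
    forall y, (mu t y : R) @[t --> U] --> (nu y : R).
Proof.
move=> muM.
have [l muc] := choice (fun y =>
  bounded_ultra_cvg UU (muM ^~ y)).
have llin : linear (l : Y -> R^o).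
  move=> a y z; apply: (cvg_unique _ (muc _)) => //.
  rewrite (_ : (fun t => _) = (fun t => a * (mu t y : R) + mu t z)).
    by apply: cvgD; [apply: cvgMl_tmp|]; exact: muc.
  by apply/funext => t; rewrite linearP.
pose nu : {linear Y -> R^o} :=
  HB.pack (l : Y -> R^o) (GRing.isLinear.Build R Y R^o *:%R l llin).
exists nu => //; apply/linear_bounded_continuous/linear_boundedP.
near=> r => y.
apply: (@le_trans _ _ (M * `|y|)).
  apply: (@closed_cvg _ R U _ (fun t => `|mu t y : R|) _
    (@closed_le R (M * `|y|))).
    by apply: filterE => t; exact: muM.
  exact: (cvg_norm (muc y)).
by rewrite ler_wpM2r//; near: r; exact: nbhs_pinfty_ge.
Unshelve. all: by end_near. Qed.

(* Dual compactness passes from pointwise eventual bounds to a norm bound: the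
   slack [N t / 4] absorbs the oscillation of [mu t] on a ball of radius 1/4. *)
Lemma dually_compact_bounded (R : realType) (Y : normedModType R)
    (Theta : set Y) (T : Type) (F : set_system T) {FF : Filter F}
    (mu : T -> {linear Y -> R^o}) (N : T -> R) :
  dually_compact Theta -> (forall t, dual_cone Theta (mu t)) ->
  (forall t, opnorm (mu t) = (N t)%:E) ->
  (forall y, exists C : R, \forall t \near F, mu t y <= C + N t / 4) ->
  exists C : R, \forall t \near F, N t <= C.
Proof.
move=> [K Kco Kmu] muT muN ptC.
have muNb t y : `|mu t y| <= N t * `|y|.
  by apply: opnorm_le_bound; rewrite muN.
have N0 t : 0 <= N t by rewrite -lee_fin -muN opnorm_ge0.
(* Near each point of [K] a pointwise bound persists with slack [N / 2]. The product filter lets the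
   constant grow together with [t], so compactness merges the local bounds into one over [K]. *)
have [[A B] /= [AF BF] AB] : \forall Ct \near filter_prod (pinfty_nbhs R) F,
    K `<=` (fun y => mu Ct.2 y <= Ct.1 + N Ct.2 / 2).
  have /compact_near_coveringP := Kco.
  apply => y _; have [C Cy] := ptC y.
  near=> y' Ct.
  have : mu Ct.2 y <= C + N Ct.2 / 4.
    by near: Ct; apply: (cvg_snd Cy).
  have : C <= Ct.1.
    near: Ct; apply: (cvg_fst (nbhs_pinfty_ge _)) => //; exact: num_real.
  have yy' : `|y' - y| <= 1 / 4.
    by near: y'; rewrite -nbhs_nearE; apply: cvgr_distC_le => //; exact: cvg_id.
  have := le_trans (ler_norm _) (muNb Ct.2 (y' - y)).
  rewrite linearB /=.
  have := ler_wpM2l (N0 Ct.2) yy'.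
  lra.
have [C AC] := filter_ex AF.
exists (2 * C); apply: filterS BF => t Bt.
suff : N t <= C + N t / 2 by lra.
rewrite -lee_fin -muN; apply: le_trans (Kmu _ (muT t)) _.
apply: ge_ereal_sup => _ [y Ky <-]; rewrite lee_fin.
exact: (AB (C, t)).
Unshelve. all: by end_near. Qed.

(** The error is measured relative to [N t], so the estimate is available before the norms are known
    to be bounded. *)
Lemma opnorm_pairing_near (R : realType) (Y : normedModType R)
    (T : Type) (F : set_system T) {FF : Filter F}
    (mu : T -> {linear Y -> R^o}) (N : T -> R) (y : T -> Y) (a : Y) (e : R) :
  (forall t, opnorm (mu t) = (N t)%:E) ->
  y t @[t --> F] --> a -> 0 < e ->
  \forall t \near F, `|mu t (y t) - mu t a| <= e * N t.
Proof.
move=> muN ya e0; near=> t.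
have N0 : 0 <= N t by rewrite -lee_fin -muN opnorm_ge0.
rewrite -linearB.
apply: (@le_trans _ _ (N t * `|y t - a|)).
  by apply: opnorm_le_bound; rewrite muN.
rewrite mulrC ler_wpM2r//; near: t.
exact: cvgr_distC_le.
Unshelve. all: by end_near. Qed.

(* [u], [gb], [ab], [t], [gk], [ak] are the values of [muk k] at [y], [g xbar],
   ['d g xbar h], [theta], [g (xk k)], ['d g (xk k) h]. *)
Lemma robinson_pairing_bound (R : realFieldType) (d s u gb ab t gk ak N : R) :
  0 < d -> - (d * u) = gb + ab + t -> 0 <= t -> - s - 1 <= ak -> -1 <= gk ->
  `|ak - ab| <= d / 8 * N -> `|gk - gb| <= d / 8 * N ->
  u <= (2 + s) / d + N / 4.
Proof.
move=> d0 muE t0 akge gkge; rewrite !ler_norml => /andP[_ abak] /andP[_ gbgk].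
(* The two errors [d / 8 * N] add up to [N / 4] after division by [d]; the 2 collects the two unit
   margins in the lower bounds on [ak] and [gk]. *)
have -> : (2 + s) / d + N / 4 = (2 + s + 2 * (d / 8 * N)) / d.
  by field; rewrite gt_eqF.
rewrite ler_pdivlMr// mulrC; lra.
Qed.

(** * Boundedness of the multipliers and passage to the limit *)

Section AKKTSequences.
Context {R : realType} {m n : nat} {Y : normedModType R}.
Variables (f : 'rV[R]_n -> 'rV[R]_m) (g : 'rV[R]_n -> Y) (Theta : set Y).
Variables (xbar : 'rV[R]_n) (lambda : 'rV[R]_m).
Variables (xk : nat -> 'rV[R]_n) (muk : nat -> {linear Y -> R^o}).
Hypothesis g_cont_diff : continuously_differentiable g.
Hypothesis akkt : AKKT_sequence f g Theta xbar lambda xk muk.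

Let v := grad_combination f lambda xbar.

(** Pairing the stationarity residual with a fixed [h] turns the adjoint into a value of [muk k]. *)
Lemma AKKT_sequence_cvg_derivative (h : 'rV[R]_n) :
  (muk k ('d g (xk k) h) : R) @[k --> \oo] --> - scalar_product v h.
Proof.
have [_ _ acvg _] := akkt.
have h0 : scalar_product 0 h = 0.
  by rewrite /scalar_product big1// => i _; rewrite mxE mul0r.
have acvg0 : (scalar_product (adjoint ('d g (xk k)) (muk k) + v) h : R)
    @[k --> \oo] --> (0 : R) by rewrite -h0; exact: scalar_product_cvg.
rewrite -[- _]add0r.
apply: cvg_trans (cvgB acvg0 (cvg_cst (scalar_product v h))).
apply: near_eq_cvg; near=> k.
by rewrite !fctE scalar_productDl scalar_product_adjoint addrK.
Unshelve. all: by end_near. Qed.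

Lemma AKKT_sequence_cvg_constraint : g (xk k) @[k --> \oo] --> g xbar.
Proof.
have [_ xkx _ _] := akkt.
exact: cvg_comp xkx (differentiable_continuous (g_cont_diff.1 xbar)).
Qed.

Lemma AKKT_sequence_cvg_diff (h : 'rV[R]_n) :
  'd g (xk k) h @[k --> \oo] --> 'd g xbar h.
Proof.
by have [_ xkx _ _] := akkt; exact: continuously_differentiable_cvg xkx.
Qed.

Lemma AKKT_sequence_bounded :
  dually_compact Theta -> RCQ g Theta xbar ->
  exists M : R, \forall k \near \oo, (opnorm (muk k) <= M%:E)%E.
Proof.
move=> Thetadc rcq; have [mukT _ _ mug0] := akkt.
have /choice[N muN] : forall k, exists c : R, opnorm (muk k) = c%:E.
  by move=> k; have [c _ ->] := continuous_opnorm (mukT k).1; exists c.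
suff [C NC] : exists C : R, \forall k \near \oo, N k <= C.
  by exists C; apply: filterS NC => k; rewrite muN lee_fin.
apply: (dually_compact_bounded Thetadc mukT muN) => y.
(* The points [- (d *: y)] tend to 0, so for small [d > 0] they enter the neighbourhood of 0 given
   by the RCQ. *)
have : - (d *: y) @[d --> (0 : R)^'+] --> (0 : Y).
  rewrite -[X in _ --> X]oppr0 -[X in _ --> - X](scale0r y).
  apply: cvgN; apply: cvgZr_tmp; exact: cvg_at_right_filter.
move=> /(_ _ rcq) rcqy.
have [d [d0 [h _ [theta Ttheta yE]]]] : exists d : R, 0 < d /\
    [set g xbar + 'd g xbar h + theta | h in setT & theta in Theta]
      (- (d *: y)).
  near (0 : R)^'+ => d; exists d; split.
    exact: (near (nbhs_right_gt 0) d).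
  by near: d; exact: rcqy.
have e0 : 0 < d / 8 by rewrite divr_gt0.
have spcvg := @AKKT_sequence_cvg_derivative h.
exists ((2 + scalar_product v h) / d); near=> k.
have : `|muk k (g (xk k)) - muk k (g xbar)| <= d / 8 * N k.
  near: k; apply: opnorm_pairing_near => //.
  exact: AKKT_sequence_cvg_constraint.
have : `|muk k ('d g (xk k) h) - muk k ('d g xbar h)| <= d / 8 * N k.
  near: k; apply: opnorm_pairing_near => //.
  exact: AKKT_sequence_cvg_diff.
have : -1 <= muk k (g (xk k)).
  by near: k; apply: (cvgr_ge _ mug0); rewrite ltrN10.
have : - scalar_product v h - 1 <= muk k ('d g (xk k) h).
  near: k; apply: (cvgr_ge _ spcvg).
  by rewrite ltrBlDr ltrDl ltr01.
have := (mukT k).2 _ Ttheta.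
have : - (d * muk k y) = muk k (g xbar) + muk k ('d g xbar h) + muk k theta.
  by have := congr1 (muk k) yE; rewrite !linearD linearN linearZ => ->.
exact: robinson_pairing_bound.
Unshelve. all: by end_near. Qed.

(** An ultrafilter replaces a weak-* convergent subsequence, which may fail to exist when [Y] is not
    separable. *)
Lemma AKKT_sequence_KKT (M : R) :
  normalized_multiplier lambda ->
  (forall k, (opnorm (muk k) <= M%:E)%E) -> KKT f g Theta xbar.
Proof.
move=> lambda1 muM; have [mukT _ _ mug0] := akkt.
have [U [UU ooU]] := ultraFilterLemma eventually_filter.
have [nu nuc mukU] := bounded_linear_ultra_cvg UU
  (fun k y => opnorm_le_bound y (muM k)).
have /choice[N muN] : forall k, exists c : R, opnorm (muk k) = c%:E.
  by move=> k; have [c _ ->] := continuous_opnorm (mukT k).1; exists c.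
(* Boundedness of the norms allows [y k] to be replaced by its limit [a]; then [muk k a] tends to
   [l] along the sequence and to [nu a] along the finer [U]. *)
have limE (y : nat -> Y) (a : Y) (l : R) : y k @[k --> \oo] --> a ->
    (muk k (y k) : R) @[k --> \oo] --> l -> nu a = l.
  move=> ya mul; apply: (cvg_unique _ (mukU a)) => //.
  have mudiff : (muk k (y k) : R) - muk k a @[k --> \oo] --> 0.
    apply/cvgr0Pnorm_le => e e0.
    have c0 : 0 < e / (`|M| + 1) by rewrite divr_gt0// ltr_wpDl.
    near=> k.
    have : `|muk k (y k) - muk k a| <= e / (`|M| + 1) * N k.
      by near: k; exact: opnorm_pairing_near.
    move=> /le_trans; apply; rewrite mulrAC ler_pdivrMr ?ltr_wpDl//.
    rewrite ler_pM2l//; have := muM k; rewrite muN lee_fin => /le_trans; apply.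
    by rewrite (le_trans (ler_norm _))// lerDl.
  have muka : (muk k a : R) @[k --> \oo] --> l.
    rewrite -[l]subr0; apply: cvg_trans (cvgB mul mudiff).
    by apply: near_eq_cvg; apply: filterE => k; rewrite !fctE subKr.
  exact: cvg_trans (cvg_app _ ooU) muka.
exists lambda, nu; split => //.
- split=> // theta Ttheta.
  apply: (@closed_cvg _ R U _ (fun k => muk k theta : R) _ (@closed_ge R 0)).
    by apply: filterE => k; exact: (mukT k).2.
  exact: mukU.
(* Testing against basis vectors reduces stationarity to scalar limits. *)
- apply/rowP => j; rewrite -!scalar_product_delta scalar_productDl.
  rewrite scalar_product_adjoint.
  rewrite (limE _ _ _ (@AKKT_sequence_cvg_diff _)
    (@AKKT_sequence_cvg_derivative _)).
  by rewrite addNr scalar_product_delta mxE.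
- exact: limE AKKT_sequence_cvg_constraint mug0.
Unshelve. all: by end_near. Qed.

End AKKTSequences.

Theorem theorem3p12 (R : realType) (m n : nat) (hm : (1 <= m)%N)
    (hn : (1 <= n)%N) (Y : completeNormedModType R)
    (f : 'rV[R]_n -> 'rV[R]_m) (g : 'rV[R]_n -> Y) (Theta : set Y)
    (xbar : 'rV[R]_n) :
  continuously_differentiable f ->
  continuously_differentiable g ->
  closed_convex_cone Theta ->
  dually_compact Theta ->
  feasible_set g Theta xbar ->
  AKKT f g Theta xbar ->
  RCQ g Theta xbar ->
  BAKKT f g Theta xbar /\ KKT f g Theta xbar.
Proof.
move=> _ g1 _ Thetadc _ [lambda [xk [muk [lambda1 akkt]]]] rcq.
have [M [k0 _ Mk]] := AKKT_sequence_bounded g1 akkt Thetadc rcq.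
(* The bound holds only from [k0] on, while BAKKT asks for every index; shifting the sequences by
   [k0] keeps all their limits. *)
have {}Mk k : (opnorm (muk (k + k0)%N) <= M%:E)%E by apply: Mk; exact: leq_addl.
have {}akkt : AKKT_sequence f g Theta xbar lambda
    (fun k => xk (k + k0)%N) (fun k => muk (k + k0)%N).
  have [mukT xkx acvg mug0] := akkt; split => [k|||]; first exact: mukT.
  - exact: cvg_comp (cvg_addnr k0) xkx.
  - exact: cvg_comp (cvg_addnr k0) acvg.
  - exact: cvg_comp (cvg_addnr k0) mug0.
split; last exact: (AKKT_sequence_KKT g1 akkt lambda1 Mk).
exists lambda, (fun k => xk (k + k0)%N), (fun k => muk (k + k0)%N).
by split=> //; exists M.
Qed.
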